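(* Let $a,b>0$, and let $\{Z_i\}_{i\ge0}$ be the AR(1) process $Z_i=-Z_{i-1}+\xi_i$, $i\ge1$ (that is, with coefficient $a_1=-1$), where $\{\xi_i\}_{i\ge1}$ are i.i.d. with density $\phi=(a+b)^{-1}\mathbf{1}_{(-a,b)}$ and are independent of $Z_0$, and where the initial distribution $\mu$, i.e. the law of $Z_0$, is arbitrary. Then $$\mathbb{P}\Big(\min_{0\le i\le n}Z_i\ge0\Big)=\Big(\frac{2b}{\pi(a+b)}\Big)^{n+o(n)}\quad(n\to\infty).$$
   Context: The notation $p_n=\lambda^{n+o(n)}$ with $\lambda\in(0,1)$ means $\lim_{n\to\infty}\frac1n\log p_n=\log\lambda$.
   Formalization: The initial distribution μ is not arbitrary but is assumed to satisfy μ([0,b)) > 0; otherwise the persistence probability is 0 for all n ≥ 1 (for example μ = δ₋₁) and the asymptotics fail. *)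

(* Defs.v *)
From HB Require Import structures.
From mathcomp Require Import all_boot all_order all_algebra.
From mathcomp Require Import all_classical all_reals all_analysis.

Set Implicit Arguments.
Unset Strict Implicit.
Unset Printing Implicit Defensive.

Import Order.TTheory GRing.Theory Num.Theory.
Import numFieldNormedType.Exports.

Local Open Scope classical_set_scope.
Local Open Scope ring_scope.

Definition has_density (d : measure_display) (T : measurableType d)
    (R : realType) (P : probability T R) (X : {RV P >-> R}) (f : R -> R) : Prop :=
  forall B : set R, measurable B ->
    distribution P X B = (\int[lebesgue_measure]_(x in B) (f x)%:E)%E.

Definition mutually_independent (d : measure_display) (T : measurableType d)
    (R : realType) (P : probability T R) (I : eqType) (D : set I)
    (X : I -> {RV P >-> R}) : Prop :=
  forall (s : seq I) (B : I -> set R),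
    uniq s -> (forall i, i \in s -> D i) -> (forall i, measurable (B i)) ->
    P [set w | forall i, i \in s -> B i (X i w)] =
      (\prod_(i <- s) P (X i @^-1` B i))%E.

(* the sigma-algebra generated by the variables X i, i in D *)
Definition sigma_process (d : measure_display) (T : measurableType d)
    (R : realType) (P : probability T R) (I : Type) (D : set I)
    (X : I -> {RV P >-> R}) : set (set T) :=
  <<s \bigcup_(i in D) [set X i @^-1` B | B in measurable] >>.

Definition independent_of_process (d : measure_display) (T : measurableType d)
    (R : realType) (P : probability T R) (I : Type) (Y : {RV P >-> R})
    (D : set I) (X : I -> {RV P >-> R}) : Prop :=
  forall (A : set R) (E : set T), measurable A -> sigma_process D X E ->
    P (Y @^-1` A `&` E) = (P (Y @^-1` A) * P E)%E.

(* xi 0 plays no role. *)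
Definition is_AR1 (d : measure_display) (T : measurableType d)
    (R : realType) (P : probability T R) (a1 : R)
    (Z xi : nat -> {RV P >-> R}) : Prop :=
  forall (i : nat) (w : T), (0 < i)%N -> Z i w = a1 * Z i.-1 w + xi i w.

Definition persistence_event (d : measure_display) (T : measurableType d)
    (R : realType) (P : probability T R) (Z : nat -> {RV P >-> R}) (n : nat)
    : set T :=
  [set w | 0 <= \big[Num.min/Z 0%N w]_(0 <= i < n.+1) Z i w].

(* p_n = lambda ^ (n + o(n)); lne takes the value -oo at 0, so a sequence with
   infinitely many zero terms does not satisfy this. *)
Definition exp_decay_rate (R : realType) (p : nat -> \bar R) (lambda : R)
    : Prop :=
  0 < lambda < 1 /\
  (fun n : nat => (n%:R^-1)%:E * lne (p n))%E @ \oo --> (ln lambda)%:E.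

(* Main.v *)
(** From a state x >= 0 the next state is uniform on (-x-a, b-x), so surviving
    one step is described by the kernel K f(x) = (a+b)^-1 int_0^{b-x} f on
    [0, b).  The function g(x) = cos(pi x / (2b)) is a positive eigenfunction of
    K with eigenvalue l = 2b / (pi (a+b)).  Hence, with
    m = E[g(Z_0); 0 <= Z_0 < b] > 0, the bound g <= 1 gives
    P(survival up to n) >= l^n m.  Conversely K 1(x) = (b-x)/(a+b) <= 2 l g(x),
    because sin t >= t/2 on [0, pi/2], so P(survival up to n) <= 2 l^n m for
    n >= 1. *)

Require Import Defs.
From HB Require Import structures.
From mathcomp Require Import all_boot all_order all_algebra.
From mathcomp Require Import all_classical all_reals all_analysis.
From mathcomp Require Import measurable_realfun ring lra.

Set Implicit Arguments.
Unset Strict Implicit.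

Import Order.TTheory GRing.Theory Num.Theory.
Import numFieldNormedType.Exports.

Local Open Scope classical_set_scope.
Local Open Scope ring_scope.

(** * Independence for random recursions *)

(** Rectangles are stable under intersection and generate the product sigma-algebra. As [m1] is
    finite, the constant sequence [setT] serves as the exhausting sequence in the uniqueness
    theorem. *)
Lemma measure_eq_on_rectangles (d1 d2 : measure_display)
    (T1 : measurableType d1) (T2 : measurableType d2) (R : realType)
    (m1 m2 : {measure set (T1 * T2) -> \bar R}) :
  (m1 setT < +oo)%E ->
  (forall A B, measurable A -> measurable B -> m1 (A `*` B) = m2 (A `*` B)) ->
  forall C, measurable C -> m1 C = m2 C.
Proof.
move=> m1T m12 C mC.
pose G : set (set (T1 * T2)) :=
  [set A `*` B | A in measurable & B in measurable].
apply: (measure_unique G (fun=> setT)) => //.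
- by rewrite measurable_prod_measurableType.
- move=> _ _ [A1 mA1 [B1 mB1 <-]] [A2 mA2 [B2 mB2 <-]]; rewrite -setXI.
  exists (A1 `&` A2); first exact: measurableI.
  by exists (B1 `&` B2) => //; exact: measurableI.
- by move=> _; exists setT => //; exists setT => //; rewrite setXTT.
- by rewrite bigcup_const//; exists 0%N.
- by move=> _ [A mA [B mB <-]]; exact: m12.
Qed.

(** By independence the law of the pair agrees with the product of the laws on rectangles, hence
    everywhere; Tonelli then iterates the integral. *)
Lemma ge0_integral_indep_pair (d : measure_display) (T : measurableType d)
    (R : realType) (P : probability T R) (X Y : {RV P >-> R})
    (h : R * R -> \bar R) :
  (forall A B, measurable A -> measurable B ->
     P (X @^-1` A `&` Y @^-1` B) = P (X @^-1` A) * P (Y @^-1` B))%E ->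
  measurable_fun [set: R * R] h -> (forall z, 0 <= h z)%E ->
  (\int[P]_w h (X w, Y w) =
   \int[distribution P X]_x \int[distribution P Y]_y h (x, y))%E.
Proof.
move=> XY mh h0.
have mXY : measurable_fun setT (fun w => (X w, Y w)).
  exact: measurable_fun_pair.
rewrite -(fubini_tonelli1 h)//.
rewrite [LHS](_ : _ = \int[pushforward P (fun w => (X w, Y w))]_z h z)%E; last first.
  by rewrite ge0_integral_pushforward.
apply: eq_measure_integral => C mC _.
by apply/esym/product_measure_unique.
Qed.

Lemma measurable_process_event (d : measure_display) (T : measurableType d)
    (R : realType) (P : probability T R) (xi : nat -> {RV P >-> R})
    (s : seq nat) (B : nat -> set R) :
  (forall i, measurable (B i)) ->
  measurable [set w | forall i, i \in s -> B i (xi i w)].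
Proof.
move=> mB; rewrite [X in measurable X](_ : _ =
    \big[setI/setT]_(i <- s) (xi i @^-1` B i)); last first.
  rewrite -bigcap_seq; apply/seteqP; split => w /= h i /=; exact: h.
by apply: bigsetI_measurable => i _; exact: measurable_funPTI.
Qed.

(** Lets [independent_of_process] be applied to finite families of noises, which starts the
    induction on time below. *)
Lemma sigma_process_event (d : measure_display) (T : measurableType d)
    (R : realType) (P : probability T R) (D : set nat)
    (xi : nat -> {RV P >-> R}) (s : seq nat) (B : nat -> set R) :
  (forall i, measurable (B i)) -> (forall i, i \in s -> D i) ->
  sigma_process D xi [set w | forall i, i \in s -> B i (xi i w)].
Proof.
move=> mB; elim: s => [_|i s IH sD].
  rewrite [X in sigma_process _ _ X](_ : _ = setT).
    exact: (@measurableT _ (g_sigma_algebraType _)).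
  by apply/seteqP; split.
rewrite [X in sigma_process _ _ X](_ : _ =
    xi i @^-1` B i `&` [set w | forall j, j \in s -> B j (xi j w)]).
  apply: (@measurableI _ (g_sigma_algebraType _)).
    apply: sub_sigma_algebra; exists i; first by apply: sD; rewrite mem_head.
    by exists (B i).
  by apply: IH => j js; apply: sD; rewrite inE js orbT.
apply/seteqP; split => w /=.
  by move=> h; split=> [|j js]; apply: h; rewrite inE ?eqxx// js orbT.
by move=> [hi h] j; rewrite inE => /orP[/eqP->//|]; exact: h.
Qed.

(* The current state of a random recursion is independent of the future noise;
   keeping a whole finite family of future noises in the statement is what
   makes the induction on the time go through. *)
Lemma recursion_indep_future (d : measure_display) (T : measurableType d)
    (R : realType) (P : probability T R) (X xi : nat -> {RV P >-> R})
    (f : R * R -> R) :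
  measurable_fun [set: R * R] f ->
  (forall n w, X n.+1 w = f (X n w, xi n.+1 w)) ->
  mutually_independent [set i : nat | (0 < i)%N] xi ->
  independent_of_process (X 0%N) [set i : nat | (0 < i)%N] xi ->
  forall (n : nat) (s : seq nat) (A : set R) (B : nat -> set R),
  uniq s -> (forall i, i \in s -> (n < i)%N) -> measurable A ->
  (forall i, measurable (B i)) ->
  (P (X n @^-1` A `&` [set w | forall i, i \in s -> B i (xi i w)]) =
   P (X n @^-1` A) * P [set w | forall i, i \in s -> B i (xi i w)])%E.
Proof.
move=> mf XS indep indep0; elim=> [|n IH] s A B us sn mA mB.
  by apply: indep0 => //; exact: sigma_process_event.
set F := [set w | _].
have mF : measurable F by exact: measurable_process_event.
have mpair : measurable_fun setT (fun w => (X n w, xi n.+1 w)).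
  exact: measurable_fun_pair.
have s'u : uniq (n.+1 :: s).
  by rewrite /= us andbT; apply/negP => /sn; rewrite ltnn.
(* The induction hypothesis is used twice, with futures [n.+1 :: s] and [[:: n.+1]]; mutual
   independence of the noises then separates [F]. *)
have rect (C D : set R) : measurable C -> measurable D ->
    (P (X n @^-1` C `&` xi n.+1 @^-1` D `&` F) =
     P F * P (X n @^-1` C `&` xi n.+1 @^-1` D))%E.
  move=> mC mD.
  (* Indices in [s] exceed [n.+1], so overriding [B] there leaves [F] unchanged. *)
  pose B' i := if i == n.+1 then D else B i.
  have mB' i : measurable (B' i) by rewrite /B'; case: ifP.
  have FE : [set w | forall i, i \in s -> B' i (xi i w)] = F.
    apply/seteqP; split => w /= h i iS; move: (h i iS); rewrite /B';
      by case: eqP => // ein; move: (sn i iS); rewrite ein ltnn.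
  have consE : [set w | forall i, i \in n.+1 :: s -> B' i (xi i w)] =
      xi n.+1 @^-1` D `&` F.
    rewrite -FE; apply/seteqP; split => w /=.
      move=> h; split=> [|j js]; last by apply: h; rewrite inE js orbT.
      by have := h n.+1 (mem_head _ _); rewrite /B' eqxx.
    by move=> [hi h] j; rewrite inE => /orP[/eqP->|]; [rewrite /B' eqxx | exact: h].
  have oneE : [set w | forall i, i \in [:: n.+1] -> B' i (xi i w)] =
      xi n.+1 @^-1` D.
    apply/seteqP; split => w /=.
      by move=> h; have := h n.+1 (mem_head _ _); rewrite /B' eqxx.
    by move=> h i; rewrite inE => /eqP ->; rewrite /B' eqxx.
  have s0 i : i \in n.+1 :: s -> [set i : nat | (0 < i)%N] i.
    by rewrite inE => /orP[/eqP->//|/sn]; exact: leq_trans.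
  rewrite -setIA -consE IH//; last first.
    by move=> i; rewrite inE => /orP[/eqP->//|/sn]; exact: leq_trans.
  rewrite -oneE IH//; last by move=> i; rewrite inE => /eqP ->.
  rewrite indep// big_cons oneE -indep//; last first.
    by move=> i iS; apply: s0; rewrite inE iS orbT.
  by rewrite FE /B' eqxx muleA muleC.
have fP : fine (P F) >= 0 by rewrite fine_ge0.
pose Y : {mfun T >-> (R * R)%type} := mfun_Sub (mem_set mpair).
(* The law of [(X n, xi n.+1)] on [F] is compared with [P F] times its full law: [rect] is equality
   on rectangles, and the set needed is the preimage of [A] under [f]. *)
pose m1 := pushforward (mrestr P mF) Y.
pose m2 := mscale (NngNum fP) (distribution P Y).
have m12 : m1 (f @^-1` A) = m2 (f @^-1` A).
  apply: measure_eq_on_rectangles => //.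
  - rewrite /= /pushforward /= /mrestr preimage_setT setTI.
    by rewrite (le_lt_trans (probability_le1 _ mF))// ltry.
  - move=> C D mC mD /=.
    by rewrite /pushforward /mrestr /mscale /= fineK ?fin_num_measure//; exact: rect.
  - by rewrite -[X in measurable X]setTI; exact: mf.
rewrite /m1 /m2 /pushforward /mrestr /mscale /= fineK ?fin_num_measure// in m12.
rewrite muleC.
have -> : X n.+1 @^-1` A = Y @^-1` (f @^-1` A).
  by apply/seteqP; split => w /=; rewrite XS.
exact: m12.
Qed.

Lemma recursion_indep_next (d : measure_display) (T : measurableType d)
    (R : realType) (P : probability T R) (X xi : nat -> {RV P >-> R})
    (f : R * R -> R) (n : nat) (A B : set R) :
  measurable_fun [set: R * R] f ->
  (forall n w, X n.+1 w = f (X n w, xi n.+1 w)) ->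
  mutually_independent [set i : nat | (0 < i)%N] xi ->
  independent_of_process (X 0%N) [set i : nat | (0 < i)%N] xi ->
  measurable A -> measurable B ->
  (P (X n @^-1` A `&` xi n.+1 @^-1` B) =
   P (X n @^-1` A) * P (xi n.+1 @^-1` B))%E.
Proof.
move=> mf XS indep indep0 mA mB.
have <- : [set w | forall i, i \in [:: n.+1] -> B (xi i w)] = xi n.+1 @^-1` B.
  apply/seteqP; split => w /=; first by apply; rewrite mem_head.
  by move=> h i; rewrite inE => /eqP ->.
have n1 i : i \in [:: n.+1] -> (n < i)%N by rewrite inE => /eqP ->.
pose H := @recursion_indep_future _ _ _ P X xi f mf XS indep indep0 n
  [:: n.+1] A (fun=> B) isT n1 mA (fun=> mB).
exact: H.
Qed.

(** * The killed chain *)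

Lemma ge0_integral_uniform_density (d : measure_display)
    (T : measurableType d) (R : realType) (P : probability T R)
    (X : {RV P >-> R}) (a b : R) (h : R -> \bar R) :
  0 < a -> 0 < b ->
  has_density X (fun x : R => (a + b)^-1 * \1_(`]- a, b[) x) ->
  measurable_fun setT h -> (forall x, 0 <= h x)%E ->
  (\int[distribution P X]_x h x =
   ((a + b)^-1)%:E * \int[lebesgue_measure]_(x in `](- a)%R, b[) h x)%E.
Proof.
move=> a0 b0 dX mh h0.
have ab : - a < b by lra.
have abE : b - - a = a + b by lra.
(* [uniform_prob] lives on [measurableTypeR R], which has the same measurable
   sets as [R] but a different display: it is pushed forward by the identity. *)
pose GR := measurableTypeR R.
have mid : measurable_fun [set: GR] (id : GR -> R) by move=> _ B mB; rewrite setTI.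
pose idR : {mfun GR >-> R} := @mfun_Sub _ _ GR R id (mem_set mid).
transitivity (\int[pushforward (uniform_prob ab) idR]_x h x)%E.
  apply: eq_measure_integral => B mB _.
  rewrite [LHS]dX// /pushforward/= /uniform_prob.
  apply: ge0_ae_eq_integral => //.
  - by apply/measurable_EFinP; apply: measurable_funM.
  - by apply/measurable_EFinP/measurable_funTS; exact: measurable_uniform_pdf.
  - by move=> x _; rewrite lee_fin mulr_ge0 ?invr_ge0 ?addr_ge0 ?(ltW a0) ?(ltW b0).
  - by move=> x _; rewrite lee_fin uniform_pdf_ge0.
  (* The open-interval density and the closed-interval uniform density differ at most at the two
     endpoints, a null set. *)
  - exists [set - a; b]; split.
    + by apply: measurableU; exact: measurable_set1.
    + by apply: countable_lebesgue_measure0; exact: finite_set_countable.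
    + move=> x /= /not_implyP[_]; apply: contra_notP => /not_orP[/eqP xa /eqP xb].
      rewrite /uniform_pdf abE indicE mem_setE in_itv/= !lt_neqAle xb eq_sym xa/=.
      by case: ifPn => _; rewrite ?mulr1 ?mulr0.
rewrite ge0_integral_pushforward//= integral_uniform// abE; congr (_ * _)%E.
by rewrite -integral_itv_bndo_bndc -?integral_itv_obnd_cbnd//;
  exact: measurable_funTS.
Qed.

(* The chain Z with absorption at -1 as soon as it becomes negative. *)
Definition killed_step {R : realType} (z : R * R) : R :=
  if (0 <= z.1) && (z.1 <= z.2) then z.2 - z.1 else -1.

Lemma measurable_killed_step (R : realType) :
  measurable_fun [set: R * R] (@killed_step R).
Proof.
apply: measurable_fun_ifT.
- by apply: measurable_and; apply: measurable_fun_ler.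
- exact: measurable_funB.
- exact: measurable_cst.
Qed.

(** A step from x >= 0 survives exactly when the noise is at least x, and the noise is below b, so
    only noise in [x, b) contributes; killed paths sit at -1, where [h] vanishes. *)
Lemma integral_killed_step (d : measure_display)
    (T : measurableType d) (R : realType) (P : probability T R)
    (X : {RV P >-> R}) (a b x : R) (h : R -> \bar R) :
  0 < a -> 0 < b ->
  has_density X (fun x : R => (a + b)^-1 * \1_(`]- a, b[) x) ->
  measurable_fun setT h -> (forall x, 0 <= h x)%E -> h (-1) = 0%E ->
  (\int[distribution P X]_y h (killed_step (x, y)) =
   if (0 <= x < b)%R then
     ((a + b)^-1)%:E * \int[lebesgue_measure]_(y in `[x, b[) h (y - x)%R
   else 0)%E.
Proof.
move=> a0 b0 dX mh h0 hN1.
have mk : measurable_fun setT (fun y => h (killed_step (x, y))).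
  apply: measurableT_comp => //; apply: measurableT_comp => //.
  exact: measurable_killed_step.
rewrite (ge0_integral_uniform_density a0 b0 dX)//.
rewrite integral_mkcond [in X in if _ then X else _]integral_mkcond.
case: ifPn => xb.
  congr (_ * _)%E; apply: eq_integral => y _; rewrite !patchE !mem_setE !in_itv/=.
  rewrite /killed_step/=; move/andP: xb => [x0 xb]; rewrite x0/=.
  have [xy|yx] := leP x y; last by rewrite hN1; case: ifP.
  by case: (ltP y b) => yb; rewrite ?andbF// (_ : - a < y)//; lra.
rewrite integral0_eq ?mule0// => y _; rewrite patchE mem_setE in_itv/=.
rewrite /killed_step/=; case: ifPn => // /andP[ay yb].
case: ifPn => // /andP[x0 xy]; exfalso; move: xb.
by rewrite x0 (le_lt_trans xy yb).
Qed.

(** The initial [killed_step (0, z0)] keeps [z0] if it is nonnegative and sends it to -1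
    otherwise. *)
Fixpoint killed_chain {R : realType} (z0 : R) (e : nat -> R) (n : nat) : R :=
  if n is m.+1 then killed_step (killed_chain z0 e m, e n)
  else killed_step (0, z0).

Lemma measurable_killed_chain (d : measure_display) (T : measurableType d)
    (R : realType) (P : probability T R) (Z0 : {RV P >-> R})
    (xi : nat -> {RV P >-> R}) (n : nat) :
  measurable_fun setT (fun w => killed_chain (Z0 w) (xi^~ w) n).
Proof.
elim: n => [|n IH] /=; apply: (measurableT_comp (@measurable_killed_step R));
  exact: measurable_fun_pair.
Qed.

Lemma killed_step_ge0 (R : realType) (z : R * R) :
  (0 <= killed_step z) = (0 <= z.1) && (z.1 <= z.2).
Proof.
rewrite /killed_step; case: ifPn => [/andP[_ ?]|_]; first by rewrite subr_ge0.
by rewrite ler0N1.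
Qed.

Lemma killed_chain_ge0P (d : measure_display) (T : measurableType d)
    (R : realType) (P : probability T R) (Z xi : nat -> {RV P >-> R})
    (n : nat) (w : T) :
  is_AR1 (-1) Z xi ->
  0 <= killed_chain (Z 0%N w) (xi^~ w) n <->
  forall i, (i <= n)%N -> 0 <= Z i w.
Proof.
move=> AR; set X := killed_chain _ _.
(* The induction must also carry that a surviving chain still equals [Z]. *)
suff : (0 <= X n <-> forall i, (i <= n)%N -> 0 <= Z i w) /\
       (0 <= X n -> X n = Z n w) by case.
elim: n => [|n [IH XZ]].
  rewrite killed_step_ge0/= lexx/=; split.
    by split=> [Z0 i|/(_ 0%N)]; [rewrite leqn0 => /eqP ->|exact].
  by move=> Z0; rewrite /X/= /killed_step/= lexx Z0/= subr0.
rewrite killed_step_ge0/=; rewrite -/(X n).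
have ZS : 0 <= X n -> xi n.+1 w - X n = Z n.+1 w.
  by move=> X0; rewrite (AR n.+1)//= -XZ// mulN1r addrC.
split; last first.
  by move=> h; rewrite /X/= /killed_step/= -/(X n) h ZS//; case/andP: h.
split.
  move=> /andP[X0]; rewrite -subr_ge0 ZS// => Zn i.
  by rewrite leq_eqVlt => /orP[/eqP ->//|]; exact: IH.1.
move=> Zge; have X0 : 0 <= X n by apply/IH => i /leqW; exact: Zge.
by rewrite X0/= -subr_ge0 ZS// Zge.
Qed.

Lemma persistence_eventP (d : measure_display) (T : measurableType d)
    (R : realType) (P : probability T R) (Z : nat -> {RV P >-> R})
    (n : nat) (w : T) :
  persistence_event Z n w <-> forall i, (i <= n)%N -> 0 <= Z i w.
Proof.
rewrite /persistence_event /= big_mkord; split.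
  by move=> /bigmin_geP[_ h] i ilen; exact: (h (Ordinal (ilen : (i < n.+1)%N))).
move=> h; apply/bigmin_geP; split; first exact: h.
by move=> i _; apply: h; rewrite -ltnS.
Qed.

(** * The eigenfunction *)

(** The cutoff gives value 0 at the cemetery state -1 and at states x >= b, from which no step
    survives. *)
Definition eigenfun {R : realType} (b x : R) : R :=
  if 0 <= x < b then cos (pi / (2 * b) * x) else 0.

Lemma measurable_eigenfun (R : realType) (b : R) :
  measurable_fun setT (eigenfun b).
Proof.
apply: measurable_fun_ifT.
- by apply: measurable_and; [exact: measurable_fun_ler|exact: measurable_fun_ltr].
- apply: continuous_measurable_fun => x.
  apply: continuous_comp; last exact: continuous_cos.
  by apply: continuousM; [exact: cst_continuous|].
- exact: measurable_cst.
Qed.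

Lemma eigenfun_gt0 (R : realType) (b x : R) : 0 <= x < b -> 0 < eigenfun b x.
Proof.
move=> xb; rewrite /eigenfun xb; move/andP: xb => [x0 xb].
have b0 : 0 < b by exact: le_lt_trans xb.
have p0 := pi_gt0 R.
apply: cos_gt0_pihalf; apply/andP; split.
  apply: (@lt_le_trans _ _ 0); first by rewrite oppr_lt0 divr_gt0.
  by rewrite !mulr_ge0// ?invr_ge0 ?mulr_ge0// ltW.
rewrite mulrAC ltr_pdivrMr ?mulr_gt0//.
rewrite (_ : pi / 2 * (2 * b) = pi * b); last by field.
by rewrite ltr_pM2l.
Qed.

Lemma eigenfun_ge0 (R : realType) (b x : R) : 0 <= eigenfun b x.
Proof.
have [xb|xb] := boolP (0 <= x < b); first exact/ltW/eigenfun_gt0.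
by rewrite /eigenfun (negbTE xb).
Qed.

Lemma eigenfun_le_indic (R : realType) (b x : R) :
  eigenfun b x <= \1_(`[0, +oo[) x.
Proof.
rewrite indicE mem_setE in_itv/= andbT /eigenfun.
by case: (0 <= x) => //=; case: ifP => _; rewrite ?cos_le1.
Qed.

(** This is the eigenvalue equation without the factor 1/(a+b): the integral is (2b/pi) sin(pi (b-x)
    / (2b)), and the complementary angle turns the sine into cos(pi x / (2b)). *)
Lemma integral_eigenfun_shift (R : realType) (b x : R) : 0 <= x < b ->
  (\int[lebesgue_measure]_(y in `[x, b[) (eigenfun b (y - x))%:E =
   (2 * b / pi * eigenfun b x)%:E)%E.
Proof.
move=> xb; have /andP[x0 ltxb] := xb.
have b0 : 0 < b by exact: le_lt_trans ltxb.
have p0 := pi_gt0 R.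
pose t : R := pi / (2 * b).
have t0 : 0 < t by rewrite divr_gt0 ?mulr_gt0.
transitivity (\int[lebesgue_measure]_(y in `[x, b[) (cos (t * (y - x)))%:E)%E.
  apply: eq_integral => y; rewrite inE/= in_itv/= => /andP[xy yb].
  by rewrite /eigenfun ifT// subr_ge0 xy/=; lra.
have ct : continuous (fun y => cos (t * (y - x))).
  move=> y; apply: continuous_comp; last exact: continuous_cos.
  by apply: continuousM; [exact: cst_continuous|apply: continuousB => //;
    exact: cst_continuous].
rewrite integral_itv_bndo_bndc; last first.
  apply/measurable_EFinP/measurable_funTS.
  exact: continuous_measurable_fun.
pose F y : R := t^-1 * sin (t * (y - x)).
have dF (y : R) : is_derive y (1 : R) F (cos (t * (y - x))).
  rewrite /F; apply: is_derive_eq.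
  by rewrite /GRing.scale/= subr0 mulr1 mulrCA mulVf ?mulr1// gt_eqF.
rewrite (@continuous_FTC2 _ (fun y => cos (t * (y - x))) F)//.
- rewrite /F subrr mulr0 sin0 mulr0 sube0; congr EFin.
  rewrite /eigenfun xb -/t.
  have -> : t * (b - x) = - (t * x) + pi / 2 by rewrite /t; field; rewrite gt_eqF.
  by rewrite sinDpihalf cosN /t invf_div.
- exact: continuous_subspaceT.
- split.
  + by move=> y _; case: (dF y).
  + apply: cvg_at_right_filter. apply: differentiable_continuous.
    by apply/derivable1_diffP; case: (dF x).
  + apply: cvg_at_left_filter. apply: differentiable_continuous.
    by apply/derivable1_diffP; case: (dF b).
- by move=> y _; rewrite derive1E; exact: derive_val.
Qed.

(** With h = x/2, the mean value theorem gives sin h = h cos c >= h cos h for some c in [0, h], so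
    sin x = 2 sin h cos h >= 2 h cos^2 h = h (1 + cos x) >= h. *)
Lemma sin_ge_half (R : realType) (x : R) : 0 <= x <= pi / 2 -> x / 2 <= sin x.
Proof.
move=> /andP[x0 xpi].
have p0 := pi_gt0 R.
have h0 : 0 <= x / 2 by rewrite divr_ge0.
have [c] := @MVT_segment R sin cos 0 (x / 2) h0
  (fun y _ => is_derive_sin y) (continuous_subspaceT (@continuous_sin R)).
rewrite in_itv/= sin0 !subr0 => /andP[c0 ch] sinh.
have cosch : cos (x / 2) <= cos c.
  move: ch; rewrite le_eqVlt => /orP[/eqP->//|ch].
  by apply/ltW; rewrite ltr_cos// in_itv/=; apply/andP; split; lra.
have xE : x = (x / 2) *+ 2 by rewrite -mulr_natr divfK.
have cosh2 : 1 <= cos (x / 2) ^+ 2 *+ 2.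
  rewrite -subr_ge0 -cos_mulr2n -xE.
  by apply: cos_ge0_pihalf; apply/andP; split; lra.
have cosh0 : 0 <= cos (x / 2) by apply: cos_ge0_pihalf; apply/andP; split; lra.
rewrite [in leRHS]xE sin_mulr2n sinh mulrA -mulrnAl -[leLHS]mul1r.
apply: ler_wpM2r => //; apply: (le_trans cosh2).
by rewrite lerMn2r/= expr2 ler_wpM2l.
Qed.

(** Apply [sin_ge_half] at the angle t (b-x) with t = pi / (2b), whose sine is cos(t x); the
    constant 4b/pi is 2/t. *)
Lemma eigenfun_ge_linear (R : realType) (b x : R) : 0 <= x < b ->
  b - x <= 4 * b / pi * eigenfun b x.
Proof.
move=> xb; have /andP[x0 ltxb] := xb.
have b0 : 0 < b by exact: le_lt_trans ltxb.
have p0 := pi_gt0 R.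
pose t : R := pi / (2 * b).
have t0 : 0 < t by rewrite divr_gt0 ?mulr_gt0.
have tb : t * (b - x) = - (t * x) + pi / 2 by rewrite /t; field; rewrite gt_eqF.
have ht : 0 <= t * (b - x) <= pi / 2.
  apply/andP; split; first by rewrite mulr_ge0 ?subr_ge0 ?(ltW t0) ?(ltW ltxb).
  by rewrite tb -lerBrDr subrr oppr_le0 mulr_ge0 ?(ltW t0).
have := sin_ge_half ht; rewrite {2}tb sinDpihalf cosN.
rewrite /eigenfun xb -/t => h.
rewrite -(ler_pM2l t0) mulrA.
have -> : 4 * b / pi = 2 * t^-1 by rewrite /t invf_div; ring.
rewrite mulrCA divff ?gt_eqF// mulr1.
lra.
Qed.

(** Since pi >= 2 and a > 0, pi (a+b) >= 2 (a+b) > 2b. *)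
Lemma decay_rate_bounds (R : realType) (a b : R) : 0 < a -> 0 < b ->
  0 < 2 * b / (pi * (a + b)) < 1.
Proof.
move=> a0 b0; have p2 := pi_ge2 R.
have p0 : 0 < pi * (a + b) by apply: mulr_gt0; lra.
apply/andP; split; first by apply: divr_gt0 => //; lra.
rewrite ltr_pdivrMr// mul1r; nra.
Qed.

(** * One-step estimates for the killed chain *)

(** The last noise is independent of the current state and can be integrated out. This serves both
    for [eigenfun] and for the indicator of survival. *)
Lemma integral_killed_chain_next (d : measure_display)
    (T : measurableType d) (R : realType) (P : probability T R) (a b : R)
    (X xi : nat -> {RV P >-> R}) (h : R -> \bar R) (n : nat) :
  0 < a -> 0 < b ->
  has_density (xi n.+1) (fun x : R => (a + b)^-1 * \1_(`]- a, b[) x) ->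
  mutually_independent [set i : nat | (0 < i)%N] xi ->
  independent_of_process (X 0%N) [set i : nat | (0 < i)%N] xi ->
  (forall n w, X n.+1 w = killed_step (X n w, xi n.+1 w)) ->
  measurable_fun setT h -> (forall x, 0 <= h x)%E -> h (-1) = 0%E ->
  (\int[P]_w h (X n.+1 w) =
   \int[distribution P (X n)]_x
     (if (0 <= x < b)%R then
        ((a + b)^-1)%:E * \int[lebesgue_measure]_(y in `[x, b[) h (y - x)%R
      else 0))%E.
Proof.
move=> a0 b0 dxi indep indep0 XS mh h0 hN1.
under eq_integral do rewrite XS.
have mhk : measurable_fun [set: R * R] (fun z => h (killed_step z)).
  exact: measurableT_comp (@measurable_killed_step R).
rewrite (@ge0_integral_indep_pair _ _ _ P (X n) (xi n.+1)
  (fun z => h (killed_step z)))//.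
  by apply: eq_integral => x _; rewrite (integral_killed_step _ a0 b0 dxi).
move=> A B mA mB.
exact: (recursion_indep_next n (@measurable_killed_step R) XS indep indep0).
Qed.

(** Integrating the eigenvalue equation against the law of [X n] makes these expectations exactly
    geometric. *)
Lemma integral_eigenfun_next (d : measure_display)
    (T : measurableType d) (R : realType) (P : probability T R) (a b : R)
    (X xi : nat -> {RV P >-> R}) (n : nat) :
  0 < a -> 0 < b ->
  has_density (xi n.+1) (fun x : R => (a + b)^-1 * \1_(`]- a, b[) x) ->
  mutually_independent [set i : nat | (0 < i)%N] xi ->
  independent_of_process (X 0%N) [set i : nat | (0 < i)%N] xi ->
  (forall n w, X n.+1 w = killed_step (X n w, xi n.+1 w)) ->
  (\int[P]_w (eigenfun b (X n.+1 w))%:E =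
   (2 * b / (pi * (a + b)))%:E * \int[P]_w (eigenfun b (X n w))%:E)%E.
Proof.
move=> a0 b0 dxi indep indep0 XS.
have l0 : 0 <= 2 * b / (pi * (a + b)).
  by have /andP[/ltW] := decay_rate_bounds a0 b0.
have me : measurable_fun setT (fun x => (eigenfun b x)%:E).
  by apply/measurable_EFinP; exact: measurable_eigenfun.
have e0 x : (0 <= (eigenfun b x)%:E)%E by rewrite lee_fin eigenfun_ge0.
rewrite (integral_killed_chain_next (h := fun x => (eigenfun b x)%:E) a0 b0 dxi)//;
  last by rewrite /eigenfun ler0N1.
rewrite -(@ge0_integral_distribution _ _ _ _ _ P (X n) (fun x => (eigenfun b x)%:E))//.
rewrite -ge0_integralZl//.
apply: eq_integral => x _; case: ifPn => xb.
  rewrite integral_eigenfun_shift// -EFinM mulrA; congr (_ * _)%:E.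
  by rewrite invfM; ring.
by rewrite /eigenfun (negbTE xb) mule0.
Qed.

Lemma survival_le_eigenfun (d : measure_display)
    (T : measurableType d) (R : realType) (P : probability T R) (a b : R)
    (X xi : nat -> {RV P >-> R}) (n : nat) :
  0 < a -> 0 < b ->
  has_density (xi n.+1) (fun x : R => (a + b)^-1 * \1_(`]- a, b[) x) ->
  mutually_independent [set i : nat | (0 < i)%N] xi ->
  independent_of_process (X 0%N) [set i : nat | (0 < i)%N] xi ->
  (forall n w, X n.+1 w = killed_step (X n w, xi n.+1 w)) ->
  (P [set w | (0 <= X n.+1 w)%R] <=
   (2 * (2 * b / (pi * (a + b))))%:E * \int[P]_w (eigenfun b (X n w))%:E)%E.
Proof.
move=> a0 b0 dxi indep indep0 XS.
have ab0 : 0 <= (a + b)^-1 by rewrite invr_ge0 ltW ?addr_gt0.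
have l0 : 0 <= 2 * (2 * b / (pi * (a + b))).
  by have /andP[/ltW l0 _] := decay_rate_bounds a0 b0; rewrite mulr_ge0.
have me : measurable_fun setT (fun x => (eigenfun b x)%:E).
  by apply/measurable_EFinP; exact: measurable_eigenfun.
have e0 x : (0 <= (eigenfun b x)%:E)%E by rewrite lee_fin eigenfun_ge0.
pose h (x : R) : \bar R := (\1_(`[0, +oo[) x)%:E.
have mh : measurable_fun setT h.
  by apply/measurable_EFinP; exact: measurable_indic.
have h0 x : (0 <= h x)%E by rewrite lee_fin.
have -> : P [set w | 0 <= X n.+1 w] = (\int[P]_w h (X n.+1 w))%E.
  have -> : [set w | 0 <= X n.+1 w] = X n.+1 @^-1` `[0, +oo[.
    by apply/seteqP; split => w /=; rewrite in_itv/= andbT.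
  transitivity (\int[P]_w (\1_(X n.+1 @^-1` `[0%R, +oo[) w)%:E)%E.
    by rewrite integral_indic ?setIT//; exact: measurable_funPTI.
  exact: eq_integral.
rewrite (integral_killed_chain_next a0 b0 dxi)//; last first.
  by rewrite /h indicE mem_setE in_itv/= ler0N1.
rewrite -(@ge0_integral_distribution _ _ _ _ _ P (X n) (fun x => (eigenfun b x)%:E))//.
rewrite -ge0_integralZl//.
have hE x : 0 <= x < b ->
    (\int[lebesgue_measure]_(y in `[x, b[) h (y - x)%R = (b - x)%:E)%E.
  move=> /andP[_ xb].
  rewrite (eq_integral (cst 1%E)); last first.
    move=> y; rewrite inE/= in_itv/= => /andP[xy _].
    by rewrite /h indicE mem_setE in_itv/= subr_ge0 xy.
  by rewrite integral_cst//= mul1e lebesgue_measure_itv/= lte_fin xb EFinB.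
(* The one-step survival probability from x; by [eigenfun_ge_linear] it is at most 4b / (pi (a+b))
   times [eigenfun b x], which is where the factor 2 comes from. *)
pose k (x : R) : R := if 0 <= x < b then (a + b)^-1 * (b - x) else 0.
rewrite (eq_integral (fun x => (k x)%:E)); last first.
  by move=> x _; rewrite /k; case: ifPn => // xb; rewrite hE// EFinM.
apply: ge0_le_integral => //.
- move=> x _; rewrite lee_fin /k; case: ifPn => // /andP[_ xb].
  by rewrite mulr_ge0// subr_ge0 ltW.
- apply/measurable_EFinP/measurable_fun_ifT.
  + by apply: measurable_and; [exact: measurable_fun_ler|exact: measurable_fun_ltr].
  + by apply: measurable_funM => //; exact: measurable_funB.
  + exact: measurable_cst.
- exact: measurable_funeM.
- move=> x _; rewrite -EFinM lee_fin /k; case: ifPn => xb; last first.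
    by rewrite mulr_ge0 ?eigenfun_ge0.
  rewrite (_ : _ * eigenfun b x = (a + b)^-1 * (4 * b / pi * eigenfun b x)).
    by rewrite ler_wpM2l// eigenfun_ge_linear.
  by rewrite invfM; ring.
Qed.

Lemma integral_eigenfun_le_survival (d : measure_display)
    (T : measurableType d) (R : realType) (P : probability T R) (b : R)
    (X : {RV P >-> R}) :
  (\int[P]_w (eigenfun b (X w))%:E <= P [set w | (0 <= X w)%R])%E.
Proof.
have -> : [set w | 0 <= X w] = X @^-1` `[0, +oo[.
  by apply/seteqP; split => w /=; rewrite in_itv/= andbT.
have mX : measurable (X @^-1` `[0, +oo[) by exact: measurable_funPTI.
rewrite -[leRHS](_ : \int[P]_w (\1_(X @^-1` `[0%R, +oo[) w)%:E = _)%E; last first.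
  by rewrite integral_indic ?setIT.
apply: ge0_le_integral => //.
- by move=> w _; rewrite lee_fin eigenfun_ge0.
- apply/measurable_EFinP; apply: measurableT_comp => //.
  exact: measurable_eigenfun.
- by apply/measurable_EFinP; exact: measurable_indic.
- by move=> w _; rewrite lee_fin; exact: eigenfun_le_indic.
Qed.

(** A zero integral would force [eigenfun b (X w)] to vanish almost everywhere, although it is
    positive on an event of positive probability. *)
Lemma integral_eigenfun_gt0 (d : measure_display)
    (T : measurableType d) (R : realType) (P : probability T R) (b : R)
    (X : {RV P >-> R}) :
  (0 < P [set w | (0 <= X w < b)%R])%E ->
  (0 < \int[P]_w (eigenfun b (X w))%:E)%E.
Proof.
move=> PX; have e0 w : (0 <= (eigenfun b (X w))%:E)%E by rewrite lee_fin eigenfun_ge0.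
rewrite lt0e integral_ge0// andbT; apply/eqP => int0.
have mf : measurable_fun setT (fun w => (eigenfun b (X w))%:E).
  apply/measurable_EFinP; apply: measurableT_comp => //.
  exact: measurable_eigenfun.
have [N [mN PN subN]] : ae_eq P setT (fun w => (eigenfun b (X w))%:E) (cst 0%E).
  apply/(ae_eq_integral_abs P measurableT mf).
  by under eq_integral do rewrite gee0_abs//.
move: PX; rewrite ltNge => /negP; apply.
rewrite -PN; apply: le_measure; rewrite ?inE//.
  rewrite (_ : [set w | _] = X @^-1` `[0, b[); first exact: measurable_funPTI.
  by apply/seteqP; split => w /=; rewrite in_itv.
move=> w /= /eigenfun_gt0 ew; apply: subN => /=.
by move=> /(_ I) [ew0]; move: ew; rewrite ew0 ltxx.
Qed.

(** * From two-sided geometric bounds to the decay rate *)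

(** After taking logarithms and dividing by the index, the constants contribute (ln c)/n and (ln
    C)/n, which tend to 0. The bounds start at index 1, which suffices for a limit. *)
Lemma exp_decay_rate_sandwich (R : realType) (p : nat -> \bar R) (l c C : R) :
  0 < l < 1 -> 0 < c ->
  (forall n, (c * l ^+ n.+1)%:E <= p n.+1 <= (C * l ^+ n.+1)%:E)%E ->
  exp_decay_rate p l.
Proof.
move=> /andP[l0 l1] c0 pb; split; first by rewrite l0.
have ln0 n : 0 < l ^+ n by rewrite exprn_gt0.
have C0 : 0 < C.
  have /andP[cp pC] := pb 0%N; have := le_trans cp pC.
  by rewrite lee_fin ler_pM2r// => /(lt_le_trans c0).
pose r n : R := fine (p n).
have pE n : p n.+1 = (r n.+1)%:E.
  have /andP[cp pC] := pb n; rewrite fineK// fin_numE.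
  by rewrite gt_eqF ?lt_eqF// ?(lt_le_trans _ cp) ?(le_lt_trans pC) ?ltry ?ltNyr.
have rb n : c * l ^+ n.+1 <= r n.+1 <= C * l ^+ n.+1.
  by have := pb n; rewrite pE !lee_fin.
have r0 n : 0 < r n.+1.
  by have /andP[+ _] := rb n; apply: lt_le_trans; rewrite mulr_gt0.
have lnE (k : R) n : 0 < k ->
    n.+1%:R^-1 * ln (k * l ^+ n.+1) = n.+1%:R^-1 * ln k + ln l.
  move=> k0; rewrite lnM ?posrE// lnXn// mulrDr; congr (_ + _).
  by rewrite -[ln l *+ _]mulr_natl mulKf// pnatr_eq0.
have cvgk (k : R) : n.+1%:R^-1 * ln k + ln l @[n --> \oo] --> ln l.
  rewrite -[X in _ --> X]add0r -[X in _ --> X + _](mul0r (ln k)).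
  apply: cvgD; last exact: cvg_cst.
  by apply: cvgM; [exact: cvg_harmonic|exact: cvg_cst].
rewrite -cvg_shiftS /=.
under eq_fun do rewrite pE lne_EFin// -EFinM.
apply: cvg_EFin; first exact: nearW.
apply: (squeeze_cvgr _ (cvgk c) (cvgk C)) => //.
apply: nearW => n /=; have /andP[cr rC] := rb n.
rewrite -!lnE//; apply/andP; split.
  by rewrite ler_pM2l ?invr_gt0// ler_ln ?posrE// mulr_gt0.
by rewrite ler_pM2l ?invr_gt0// ler_ln ?posrE// mulr_gt0.
Qed.

Unset Implicit Arguments.
Set Strict Implicit.

(* Without mu([0, b)) > 0, almost surely Z_0 < 0 or Z_1 < 0, so the persistence
   probability vanishes for all n >= 1 and the claim fails. *)
Theorem proposition3p5 (R : realType) (d : measure_display)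
    (T : measurableType d) (P : probability T R) (a b : R)
    (mu : probability R R) (Z xi : nat -> {RV P >-> R})
    (ha : 0 < a) (hb : 0 < b)
    (hAR : is_AR1 (-1) Z xi)
    (hdens : forall i : nat, (0 < i)%N ->
       has_density (xi i) (fun x : R => (a + b)^-1 * \1_(`]- a, b[) x))
    (hindep : mutually_independent [set i : nat | (0 < i)%N] xi)
    (hZ0xi : independent_of_process (Z 0%N) [set i : nat | (0 < i)%N] xi)
    (hmu : forall A : set R, measurable A -> distribution P (Z 0%N) A = mu A)
    (hmu_pos : (0 < mu [set x : R | (0 <= x < b)%R])%E) :
  exp_decay_rate (fun n : nat => P (persistence_event Z n))
    (2 * b / (pi * (a + b))).
Proof.
pose W n : {RV P >-> R} := mfun_Sub (mem_set (measurable_killed_chain (Z 0%N) xi n)).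
have WS n w : W n.+1 w = killed_step (W n w, xi n.+1 w) by [].
(* [W 0] is a measurable function of [Z 0], so it inherits the independence. *)
have W0indep : independent_of_process (W 0%N) [set i : nat | (0 < i)%N] xi.
  move=> A E mA sE.
  have mk : measurable_fun setT (fun z : R => killed_step (0, z)).
    apply: (measurableT_comp (@measurable_killed_step R)).
    exact: measurable_fun_pair.
  apply: (hZ0xi ((fun z => killed_step (0, z)) @^-1` A)) => //.
  by rewrite -[X in measurable X]setTI; exact: mk.
pose l := 2 * b / (pi * (a + b)).
have l01 : 0 < l < 1 by exact: decay_rate_bounds.
have l0 : 0 < l by case/andP: l01.
pose M n := (\int[P]_w (eigenfun b (W n w))%:E)%E.
have MS n : M n.+1 = (l%:E * M n)%E.
  by apply: (integral_eigenfun_next ha hb (hdens n.+1 _) hindep W0indep WS).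
have pW n : P (persistence_event Z n) = P [set w | 0 <= W n w].
  congr (P _); apply/seteqP; split => w /=.
    by move=> /persistence_eventP; apply: (killed_chain_ge0P n w hAR).2.
  by move=> /(killed_chain_ge0P n w hAR) h; apply/persistence_eventP.
have mge0 n : measurable [set w | 0 <= W n w].
  rewrite (_ : [set w | _] = W n @^-1` `[0, +oo[); first exact: measurable_funPTI.
  by apply/seteqP; split => w /=; rewrite in_itv/= andbT.
(* On the event 0 <= Z_0 < b the killed chain starts at Z_0, so [hmu_pos] transfers to [W 0]. *)
have M0gt0 : (0 < M 0%N)%E.
  apply: integral_eigenfun_gt0; apply: (lt_le_trans hmu_pos).
  have mI : measurable [set x : R | 0 <= x < b].
    rewrite (_ : [set x | _] = `[0, b[%classic); first exact: measurable_itv.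
    by apply/seteqP; split => w /=; rewrite in_itv.
  have mW0 : measurable [set w | 0 <= W 0%N w < b].
    rewrite (_ : [set w | _] = W 0%N @^-1` [set x | 0 <= x < b])//.
    exact: measurable_funPTI.
  rewrite -hmu// /distribution/= /pushforward/=.
  apply: le_measure; rewrite ?inE//; first exact: measurable_funPTI.
  move=> w /= /andP[Z0 Zb].
  by rewrite /killed_step/= lexx Z0/= subr0 Z0.
have M0fin : M 0%N \is a fin_num.
  rewrite ge0_fin_numE ?ltW//.
  apply: (le_lt_trans (integral_eigenfun_le_survival b (W 0%N))).
  by rewrite (le_lt_trans (probability_le1 _ (mge0 0%N)))// ltry.
have ME n : M n = (fine (M 0%N) * l ^+ n)%:E.
  elim: n => [|n IH]; first by rewrite mulr1 fineK.
  by rewrite MS IH -EFinM exprS mulrCA.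
(* Survival up to n+1 is at least [M n.+1], and at most 2 l [M n] = 2 [M n.+1]; this gives the
   constants [M 0] and 2 [M 0]. *)
apply: (@exp_decay_rate_sandwich _ _ _ (fine (M 0%N)) (2 * fine (M 0%N))) => //.
  by rewrite fine_gt0// M0gt0 -ge0_fin_numE ?ltW.
move=> n; rewrite pW -ME; apply/andP; split.
  exact: integral_eigenfun_le_survival.
have := survival_le_eigenfun ha hb (hdens n.+1 isT) hindep W0indep WS.
move=> /le_trans; apply; rewrite -/(M n) ME -EFinM lee_fin -/l.
by rewrite le_eqVlt exprS; apply/orP; left; apply/eqP; ring.
Qed.
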